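(* Let $H$ be a fixed multicyclic connected planar graph and let $m(n)$ be non-negative integers with $\limsup_{n\to\infty} m(n)/n<1$. Then \[ \mathbf{P}[P_{n,m}\text{ has a subgraph isomorphic to } H]\to 0 \quad\text{as } n\to\infty. \]
   Context: $\mathcal{P}(n,m)$ denotes the set of all (simple, labelled) planar graphs on the vertex set $\{1,2,\ldots,n\}$ with exactly $m$ edges, and $P_{n,m}$ denotes a graph chosen uniformly at random from $\mathcal{P}(n,m)$. A connected graph $H$ is multicyclic if $e(H)>|H|$, where $e(H)$ is its number of edges and $|H|$ its number of vertices. A copy of $H$ means any (not necessarily induced) subgraph isomorphic to $H$. *)

(* Defs.v *)
From HB Require Import structures.
From mathcomp Require Import all_boot all_order all_algebra.
From mathcomp Require Import all_classical all_reals all_analysis.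

Set Implicit Arguments.
Unset Strict Implicit.
Unset Printing Implicit Defensive.

Import Order.TTheory GRing.Theory Num.Theory.
Import numFieldNormedType.Exports.

Local Open Scope classical_set_scope.
Local Open Scope ring_scope.

(* A graph on a finite vertex type V is given by its set of edges. *)
Definition simple_graph (V : finType) (E : {set {set V}}) : bool :=
  [forall e in E, #|e| == 2].

Definition adj (V : finType) (E : {set {set V}}) : rel V :=
  fun x y => [set x; y]%SET \in E.

Definition connected_graph (V : finType) (E : {set {set V}}) : bool :=
  (0 < #|V|)%N && [forall x, forall y, connect (adj E) x y].

Definition multicyclic (V : finType) (E : {set {set V}}) : bool :=
  connected_graph E && (#|V| < #|E|)%N.

(* The edge e is drawn as the simple arc c e, parametrised by [0, 1], between
   the points representing its two ends; the interior of an arc contains no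
   vertex and no point of any other arc. *)
Definition planar (R : realType) (V : finType) (E : {set {set V}}) : Prop :=
  exists (p : V -> R * R) (c : {set V} -> R -> R * R),
    [/\ injective p,
        forall e, e \in E ->
          [/\ {within `[0, 1]%classic, continuous (c e)},
              {in `[0, 1] &, injective (c e)} &
              exists x y : V, [/\ e = [set x; y]%SET, c e 0 = p x & c e 1 = p y]],
        forall e, e \in E -> forall t : R, t \in `]0, 1[ ->
          forall v : V, c e t <> p v
      & forall e e', e \in E -> e' \in E -> e != e' ->
          forall t t' : R, t \in `]0, 1[ -> t' \in `[0, 1] -> c e t <> c e' t'].

(* The image of H under some injection of the vertices is a subgraph of G;
   it need not be induced. *)
Definition has_copy (V W : finType) (H : {set {set V}}) (G : {set {set W}}) :
    bool :=
  [exists f : {ffun V -> W},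
     injectiveb f && ([set f @: e | e : {set V} in H] \subset G)%SET].

(* The vertex set {1, ..., n} is represented by 'I_n = {0, ..., n - 1}. *)
Definition planar_graphs (R : realType) (n m : nat) : {set {set {set 'I_n}}} :=
  [set E : {set {set 'I_n}} |
    [&& simple_graph E, #|E| == m & `[< planar R E >]]]%SET.

(* Probability of A under the uniform distribution on S (0 if S is empty). *)
Definition prob_uniform (R : realType) (T : finType) (S : {set T})
    (A : pred T) : R :=
  #|[set x in S | A x]%SET|%:R / #|S|%:R.

(* Main.v *)
(** A graph with [n] vertices and [j] edges has at least [n - j] tree
components.  A planar drawing of the rest of the graph stays put while a tree
component is redrawn leaf by leaf close to any vertex [x] outside it; so every
such [x] can be joined to each tree component without losing planarity.  Double
counting the pairs (graph, added edge) gives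
[|P(n, j)| n (n - j - 1) <= |P(n, j + 1)| 4 (j + 1)].  Deleting a copy of [H]
from a graph of [P(n, m)] leaves a graph of [P(n, m - e(H))], and the deleted
copy is determined by one of at most [n ^ |H|] maps.  Iterating the inequality
[e(H)] times with [n - m >= d n], the probability is at most
[(4 / d) ^ e(H) n ^ (|H| - e(H))], which tends to [0] as [e(H) > |H|]. *)
Require Import Defs.
From HB Require Import structures.
From mathcomp Require Import all_boot all_order all_algebra.
From mathcomp Require Import all_classical all_reals all_analysis.
From mathcomp Require Import zify ring lra.

Set Implicit Arguments.
Unset Strict Implicit.
Unset Printing Implicit Defensive.

Import Order.TTheory GRing.Theory Num.Theory.
Import numFieldNormedType.Exports.

Local Open Scope classical_set_scope.
Local Open Scope ring_scope.

(** * Redrawing arcs as radii inside a small disc *)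

Lemma within_continuous_norm_sub (R : realType) (U : normedModType R)
    (A : set R) (c : R -> U) (x0 : U) :
  {within A, continuous c} -> {within A, continuous (fun t => `|c t - x0|)}.
Proof.
move=> cc t.
apply: (@continuous_comp (subspace A) U R c (fun y => `|y - x0|) t); first exact: cc.
apply: (@continuous_comp U U R (fun y => y - x0) Num.norm).
  by apply: continuousB; [exact: cvg_id | exact: cst_continuous].
exact: norm_continuous.
Qed.

(** The times at which the arc is at distance [r] from [x0] form a nonempty compact set, and [t0] is
    its maximum. A later point in the closed disc would give, by the intermediate value theorem, a
    still later such time. *)
Lemma last_exit (R : realType) (U : normedModType R) (x0 : U) (r : R)
    (c : R -> U) :
  0 < r -> {within `[0, 1]%classic, continuous c} -> c 0 = x0 ->
  r < `|c 1 - x0| ->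
  exists2 t0, t0 \in `]0, 1[ &
    `|c t0 - x0| = r /\ (forall t : R, t \in `]t0, 1] -> r < `|c t - x0|).
Proof.
move=> r0 cc c0 c1.
have nc := within_continuous_norm_sub (x0 := x0) cc.
pose g t := `|c t - x0|.
have g0 : g 0 = 0 by rewrite /g c0 subrr normr0.
have [u u01 gu] : exists2 u, u \in `[0, 1] & g u = r.
  apply: IVT => //; rewrite g0 ge_min ltW //= le_max.
  by rewrite (ltW c1) orbT.
have [W cW WE] : exists2 W : set R, closed W &
    W `&` `[0, 1]%classic = g @^-1` [set r] `&` `[0, 1]%classic.
  apply/closed_subspaceP.
  by move/continuous_closedP : nc; apply; exact: closed_eq.
have cA : compact (W `&` `[0, 1]%classic).
  by rewrite setIC; apply: compact_closedI => //; exact: segment_compact.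
have [||t0 t0A t0max] := @compact_EVT_max _ R id _ _ cA.
- by exists u; rewrite WE; split.
- by apply: continuous_subspaceT => z; exact: cvg_id.
have : (W `&` `[0, 1]%classic) t0 by rewrite inE in t0A.
rewrite WE /= in_itv /= => -[gt0 /andP[t00 t01]].
have t0N0 : t0 != 0 by apply: contra_eq_neq gt0 => ->; rewrite g0 lt_eqF.
have t0N1 : t0 != 1 by apply: contra_eq_neq gt0 => ->; rewrite gt_eqF.
exists t0; first by rewrite in_itv /= !lt_neqAle eq_sym t0N0 t00 t0N1 t01.
split=> // t; rewrite in_itv /= => /andP[t0t tle1].
rewrite ltNge; apply/negP => gt.
have t0' : 0 <= t by rewrite (le_trans t00)// ltW.
have [w] : exists2 w, w \in `[t, 1] & g w = r.
  apply: IVT => //.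
    apply: (continuous_subspaceW _ nc) => z /=; rewrite !in_itv /= => /andP[tz ->].
    by rewrite (le_trans t0' tz).
  by rewrite ge_min gt /= le_max (ltW c1) orbT.
rewrite in_itv /= => /andP[tw w1] gw.
have := t0max w; rewrite inE WE => /(_ _); rewrite leNgt (lt_le_trans t0t tw).
by move/(_ _)/negP; apply=> //; split => //=; rewrite in_itv /= (le_trans t0' tw).
Qed.

(* A point of the redrawn arc lies on the radius from [x0] to [b], or is a point
   of the original arc outside the disc. *)
Definition near_or_old (R : realType) (U : normedModType R) (x0 : U) (r : R)
    (c : R -> U) (b : U) (y : U) : Prop :=
  (`|b - x0| = r /\ exists2 s, s \in `]0, 1] & y = x0 + s *: (b - x0)) \/
  (r < `|y - x0| /\ exists2 t, t \in `]0, 1[ & y = c t).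

(** Follow the radius from [x0] to the last exit point [c t0], then the old arc. The first piece
    stays in the closed disc and the second outside it, so the new arc is again simple. *)
Lemma straighten (R : realType) (U : normedModType R) (x0 : U) (r : R)
    (c : R -> U) :
  0 < r -> {within `[0, 1]%classic, continuous c} ->
  {in `[0, 1] &, injective c} -> c 0 = x0 -> r < `|c 1 - x0| ->
  exists (c' : R -> U) (t0 : R),
    [/\ t0 \in `]0, 1[, {within `[0, 1]%classic, continuous c'},
        {in `[0, 1] &, injective c'}, c' 0 = x0 /\ c' 1 = c 1 &
        forall t : R, t \in `]0, 1[ -> near_or_old x0 r c (c t0) (c' t)].
Proof.
move=> r0 cc ci c0 c1.
have [t0 t001 [ct0 far]] := last_exit r0 cc c0 c1.
move: (t001); rewrite in_itv /= => /andP[t00 t01].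
pose seg t := x0 + (t / t0) *: (c t0 - x0).
pose c' t := if t <= t0 then seg t else c t.
have cseg : continuous seg.
  move=> t; apply: cvgD; first exact: cvg_cst.
  by apply: cvgZr_tmp; apply: cvgMr_tmp.
have nseg t : 0 <= t -> `|seg t - x0| = (t / t0) * r.
  by move=> t_ge0; rewrite /seg addrC addKr normrZ ct0 ger0_norm // divr_ge0 // ltW.
have nseg_le t : 0 <= t -> t <= t0 -> `|seg t - x0| <= r.
  by move=> t_ge0 tt0; rewrite nseg // ler_piMl ?(ltW r0) // ler_pdivrMr // mul1r.
have rx : c t0 - x0 != 0 by rewrite -normr_gt0 ct0.
exists c', t0; split => //.
- have -> : `[0, 1]%classic = `[0, t0]%classic `|` `[t0, 1]%classic.
    apply/seteqP; split=> z /=; rewrite !in_itv /=.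
      by move=> /andP[-> ->]; case: (leP z t0) => [_|/ltW ->]; [left|right].
    move=> [/andP[-> zt0]|/andP[t0z ->]]; first by rewrite (le_trans zt0) // ltW.
    by rewrite (le_trans (ltW t00) t0z).
  apply: withinU_continuous; [exact: itv_closed|exact: itv_closed| |].
  + have : {within `[0, t0]%classic, continuous seg} by exact: continuous_subspaceT.
    apply: subspace_eq_continuous => t; rewrite inE /= in_itv /= => /andP[_ tt0].
    by rewrite /c' /= /from_subspace tt0.
  + have : {within `[t0, 1]%classic, continuous c}.
      apply: continuous_subspaceW cc => z /=; rewrite !in_itv /= => /andP[tz ->].
      by rewrite (le_trans (ltW t00) tz).
    apply: subspace_eq_continuous => t; rewrite inE /= in_itv /= => /andP[t0t _].
    rewrite /c' /= /from_subspace; case: ifPn => // tt0.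
    have -> : t = t0 by apply/le_anti/andP.
    by rewrite /seg divff ?gt_eqF // scale1r addrC subrK.
- move=> t u; rewrite !in_itv /= => /andP[t_ge0 t_le1] /andP[u_ge0 u_le1].
  rewrite /c'; case: (leP t t0) => tt0; case: (leP u t0) => ut0.
  + move=> /addrI /eqP; rewrite -subr_eq0 -scalerBl scaler_eq0 (negPf rx) orbF.
    rewrite subr_eq0 => /eqP /(mulIf _); apply.
    by rewrite invr_eq0 gt_eqF.
  + move=> E; have := far u; rewrite -E in_itv /= ut0 u_le1 => /(_ isT).
    by rewrite ltNge nseg_le.
  + move=> E; have := far t; rewrite E in_itv /= tt0 t_le1 => /(_ isT).
    by rewrite ltNge nseg_le.
  + by apply: ci; rewrite in_itv /= ?t_ge0 ?u_ge0.
- by rewrite /c' (ltW t00) leNgt t01 /seg mul0r scale0r addr0.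
- move=> t; rewrite in_itv /= => /andP[t_gt0 t_lt1]; rewrite /c'.
  case: (leP t t0) => tt0; [left|right].
    split=> //; exists (t / t0) => //.
    by rewrite in_itv /= divr_gt0 //= ler_pdivrMr // mul1r.
  split; first by apply: far; rewrite in_itv /= tt0 ltW.
  by exists t => //; rewrite in_itv /= t_gt0.
Qed.

Lemma positive_lower_bound (R : realType) (I : finType) (f : I -> R) :
  (forall i, 0 < f i) -> exists2 r, 0 < r & forall i, r < f i.
Proof.
(* The default 1 covers an empty [I]; halving the minimum makes the bound strict. *)
move=> f0; pose M := \big[Order.min/1]_i f i.
have M0 : 0 < M by rewrite lt_bigmin.
exists (M / 2); first by rewrite divr_gt0.
move=> i; rewrite (lt_le_trans (y := M)) ?bigmin_le_cond // ltr_pdivrMr //.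
by rewrite mulr2n mulrDr mulr1 ltrDl.
Qed.

(** The midpoint between 1 and the largest entry below 1 (or 0, if larger) works. This will choose a
    free direction for the new radius. *)
Lemma avoid_seq (R : realType) (l : seq R) :
  exists2 s, s \in `[0, 1] & s \notin l.
Proof.
pose M := \big[Order.max/0]_(i <- l | i < 1) i.
have M0 : 0 <= M by exact: bigmax_ge_id.
have M1 : M < 1 by apply: bigmax_lt => //.
exists ((1 + M) / 2).
  rewrite in_itv /= divr_ge0 ?addr_ge0 //= ler_pdivrMr // mul1r.
  by rewrite mulr2n lerD2l ltW.
have s1 : (1 + M) / 2 < 1 by rewrite ltr_pdivrMr // mul1r mulr2n ltrD2l.
apply/negP => sl.
have : (1 + M) / 2 <= M by have := @le_bigmax_seq _ R R l 0 _ (fun i => i < 1) id sl s1.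
by rewrite ler_pdivrMr // mulr2n mulrDr mulr1 lerD2r leNgt M1.
Qed.

Lemma arc_away (R : realType) (U : normedModType R) (x0 : U) (c : R -> U) :
  {within `[0, 1]%classic, continuous c} -> (forall t : R, t \in `[0, 1] -> c t <> x0) ->
  exists2 d, 0 < d & forall t : R, t \in `[0, 1] -> d <= `|c t - x0|.
Proof.
move=> cc cx; have nc := within_continuous_norm_sub (x0 := x0) cc.
have [u u01 umin] := EVT_min ler01 nc.
exists `|c u - x0| => //; rewrite normr_gt0 subr_eq0.
by apply/eqP/cx.
Qed.

Lemma redraw_arc (R : realType) (U : normedModType R) (V : finType)
    (e : {set V}) (p : V -> U) (x : V) (c : R -> U) (r : R) :
  0 < r -> (forall w, w != x -> r < `|p w - p x|) ->
  (x \notin e -> forall t : R, t \in `[0, 1] -> r < `|c t - p x|) ->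
  {within `[0, 1]%classic, continuous c} -> {in `[0, 1] &, injective c} ->
  (exists a b, [/\ e = [set a; b]%SET, c 0 = p a & c 1 = p b]) ->
  exists (c' : R -> U) (t0 : R),
    [/\ t0 \in `]0, 1[, {within `[0, 1]%classic, continuous c'},
        {in `[0, 1] &, injective c'},
        exists a b, [/\ e = [set a; b]%SET, c' 0 = p a & c' 1 = p b] &
        forall t : R, t \in `]0, 1[ -> near_or_old (p x) r c (c t0) (c' t)].
Proof.
move=> r0 pr far cc ci [a [b [eE c0 c1]]].
have ab : a != b.
  apply/eqP => ab; have : c 0 = c 1 by rewrite c0 c1 ab.
  by move/ci => /(_ _ _)/eqP; rewrite !in_itv /= !lexx !ler01 eq_sym oner_eq0 => /(_ isT isT).
have [xa|xa] := eqVneq x a.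
  have [||c' [t0 [t001 cc' ci' [c'0 c'1] no]]] := straighten r0 cc ci (x0 := p x).
  - by rewrite c0 xa.
  - by rewrite c1 pr // xa eq_sym.
  exists c', t0; split => //; exists a, b; split => //.
    by rewrite c'0 xa.
  by rewrite c'1.
have [xb|xb] := eqVneq x b.
  (* Here [x] is the final end of the arc, so the reversed arc is straightened and its exit time
     [t0] becomes [1 - t0]. *)
  pose d t := c (1 - t).
  have inj (t : R) : t \in `[0, 1] -> 1 - t \in `[0, 1].
    by rewrite !in_itv /= => /andP[t0 t1]; rewrite subr_ge0 t1 gerBl.
  have cd : {within `[0, 1]%classic, continuous d}.
    apply/continuous_closedP => B cB; apply/closed_subspaceP.
    have /closed_subspaceP[W cW WE] := (proj1 (continuous_closedP _) cc) B cB.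
    exists ((fun t => 1 - t) @^-1` W).
      apply: preimage_closed cW => t _; apply: continuousB; last exact: cvg_id.
      exact: cst_continuous.
    apply/seteqP; split => t /= [Bt t01]; have t01' := inj _ t01; split => //.
      by have [] : ((c @^-1` B) `&` `[0, 1]%classic) (1 - t) by rewrite -WE; split.
    by have [] : (W `&` `[0, 1]%classic) (1 - t) by rewrite WE; split.
  have id : {in `[0, 1] &, injective d}.
    move=> t u /inj ht /inj hu /ci; move/(_ ht hu)/addrI/oppr_inj; exact.
  have [||c' [t0 [t001 cc' ci' [c'0 c'1] no]]] := straighten r0 cd id (x0 := p x).
  - by rewrite /d subr0 c1 xb.
  - by rewrite /d subrr c0 pr // xb.
  have sym (t : R) : t \in `]0, 1[ -> 1 - t \in `]0, 1[.
    by rewrite !in_itv /= => /andP[t0' t1]; rewrite subr_gt0 t1 gtrBl.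
  exists c', (1 - t0); split => //; first exact: sym.
    exists b, a; split => //.
    - by rewrite finset.setUC.
    - by rewrite c'0 xb.
    - by rewrite c'1 /d subrr.
  move=> t /no [[? [s s01 tE]]|[? [s s01 tE]]]; [left|right]; split=> //.
    by exists s.
  by exists (1 - s) => //; exact: sym.
(* The arc avoids the disc and is kept; the value 1/2 for [t0] is arbitrary. *)
have xe : x \notin e by rewrite eE !inE negb_or xa.
exists c, (1 / 2); split=> //.
- by rewrite in_itv /= divr_gt0 //= ltr_pdivrMr // mul1r ltr1n.
- by exists a, b.
- move=> t t01; right; split; last by exists t.
  apply: far => //; move: t01; rewrite !in_itv /= => /andP[? ?].
  by rewrite !ltW.
Qed.

(* Inside a small disc around [x] the arcs are replaced by radii, which leaves
   room for one more radius, leading to the relocated vertex [v]. *)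
Lemma planar_pendant (R : realType) (V : finType) (E : {set {set V}}) (x v : V) :
  planar R E -> x != v -> (forall e, e \in E -> v \notin e) ->
  planar R ([set x; v]%SET |: E)%SET.
Proof.
move=> [p [c [pinj arcs intv intc]]] xv isov.
pose x0 := p x.
have ends (t : R) : t \in `[0, 1] -> [\/ t = 0, t = 1 | t \in (`]0, 1[ : interval R)].
  move=> t01; have [->|t_neq0] := eqVneq t 0; first by constructor 1.
  have [->|t_neq1] := eqVneq t 1; first by constructor 2.
  by constructor 3; move: t01; rewrite !in_itv /= !lt_neqAle t_neq1 eq_sym t_neq0.
(* The disc must miss every arc that does not end at [x], and every other vertex. The value 1 stands
   in where there is no constraint. *)
have /boolp.choice[d0 d0P] : forall e : {set V}, exists d : R, 0 < d /\
    (e \in E -> x \notin e -> forall t : R, t \in `[0, 1] -> d <= `|c e t - x0|).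
  move=> e.
  have [eE|eE] := boolP (e \in E); last by exists 1; split.
  have [xe|xe] := boolP (x \in e); first by exists 1; split.
  have [cc ci [a [b [eab c0 c1]]]] := arcs e eE.
  have [|d d_gt0 dP] := @arc_away _ (R * R)%type x0 _ cc; last by exists d.
  move: xe; rewrite {1}eab !inE negb_or => /andP[xa xb].
  move=> t /ends[->|->|t01].
  - by rewrite c0 => /pinj /eqP; rewrite eq_sym (negPf xa).
  - by rewrite c1 => /pinj /eqP; rewrite eq_sym (negPf xb).
  - exact: intv.
have [r1 r1_gt0 r1P] := positive_lower_bound (fun e => proj1 (d0P e)).
have [r2 r2_gt0 r2P] : exists2 r, 0 < r & forall w, r < if w == x then 1 else `|p w - x0|.
  apply: positive_lower_bound => w; case: eqVneq => // wx.
  by rewrite normr_gt0 subr_eq0 (inj_eq pinj).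
pose r := Order.min r1 r2.
have r0 : 0 < r by rewrite lt_min r1_gt0.
have rw w : w != x -> r < `|p w - x0|.
  by move=> wx; have := r2P w; rewrite (negPf wx); apply: le_lt_trans;
    rewrite ge_min lexx orbT.
have re e : e \in E -> x \notin e -> forall t : R, t \in `[0, 1] -> r < `|c e t - x0|.
  move=> eE xe t t01; have [_ /(_ eE xe t t01)] := d0P e.
  by apply: lt_le_trans; apply: le_lt_trans (r1P e); rewrite ge_min lexx.
have /boolp.choice[f fP] : forall e : {set V}, exists f : (R -> R * R) * R, e \in E ->
    [/\ f.2 \in `]0, 1[, {within `[0, 1]%classic, continuous f.1},
        {in `[0, 1] &, injective f.1},
        exists a b, [/\ e = [set a; b]%SET, f.1 0 = p a & f.1 1 = p b] &
        forall t : R, t \in `]0, 1[ ->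
          near_or_old (U := (R * R)%type) x0 r (c e) (c e f.2) (f.1 t)].
  move=> e.
  have [eE|eE] := boolP (e \in E); last by exists (c e, 0).
  have [cc ci ab] := arcs e eE.
  have [c' [t0 H]] := redraw_arc (U := (R * R)%type) r0 rw (re e eE) cc ci ab.
  by exists (c', t0).
(* The norm on [R * R] is the maximum norm, so [(1, s)] has norm 1 for every [s] in [[0, 1]]. The
   new end [q] thus lies on the boundary of the disc, and [s] is chosen so that its second
   coordinate differs from those of all exit points. *)
have [s s01 sP] := avoid_seq [seq ((c e (f e).2).2 - x0.2) / r | e <- enum E].
pose q : R * R := x0 + r *: (1, s).
have qx0 : `|q - x0| = r.
  rewrite /q addrC addKr normrZ gtr0_norm // prod_normE /= normr1.
  move: s01; rewrite in_itv /= => /andP[s_ge0 s_le1].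
  by rewrite ger0_norm // max_l // mulr1.
have qc e : e \in E -> q <> c e (f e).2.
  move=> eE qE; move/negP: sP; apply; apply/mapP; exists e; first by rewrite mem_enum.
  by rewrite -qE /q /= addrC addKr mulrC mulKf // gt_eqF.
pose ev := [set x; v]%SET.
have evE : ev \notin E by apply/negP => /isov; rewrite !inE eqxx orbT.
(* The isolated vertex [v] is moved to [q]; [b e] is the boundary point at which the radius
   belonging to [e] ends. *)
pose p' w := if w == v then q else p w.
pose c' e := if e == ev then (fun t => x0 + t *: (q - x0)) else (f e).1.
pose b e := if e == ev then q else c e (f e).2.
have p'E w : w != v -> p' w = p w by rewrite /p' => /negPf ->.
have bE e : e \in E -> b e = c e (f e).2.
  by rewrite /b => eE; case: eqVneq => // eev; move: evE; rewrite -eev eE.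
have bev : b ev = q by rewrite /b eqxx.
have radial_norm e y s' : 0 < s' -> `|b e - x0| = r -> y = x0 + s' *: (b e - x0) ->
    `|y - x0| = s' * r.
  by move=> s'0 br ->; rewrite addrC addKr normrZ br gtr0_norm.
(* Inner points of new arcs are either on a radius, at distance [s * r] from [x0], or old points
   outside the disc. A radius reaches the boundary at an inner time only for an old edge, hence
   never at [q]. *)
have no e t : e \in (ev |: E)%SET -> t \in `]0, 1[ ->
    (exists s, [/\ 0 < s, s <= 1, b e = q -> s < 1, `|b e - x0| = r &
       c' e t = x0 + s *: (b e - x0)]) \/
    [/\ e \in E, r < `|c' e t - x0| & exists2 t', t' \in `]0, 1[ & c' e t = c e t'].
  rewrite in_setU1 /c' => /predU1P[->|eE] t01.
    left; exists t; move: t01; rewrite bev eqxx in_itv /= => /andP[t0 t1].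
    by split=> //; exact: ltW.
  have [_ _ _ _ /(_ t t01)] := fP e eE.
  have -> : e == ev = false by apply/eqP => eev; move: evE; rewrite -eev eE.
  case=> [[br [u]]|[yr ty]]; last by right.
  rewrite in_itv /= => /andP[u0 u1] yE; left; exists u; rewrite bE //.
  by split=> // /esym /(qc e eE).
have binj e e' : e \in (ev |: E)%SET -> e' \in (ev |: E)%SET -> e != e' -> b e <> b e'.
  rewrite !in_setU1 => /predU1P[->|eE] /predU1P[->|e'E]; rewrite ?eqxx // => ne.
  - by rewrite bev bE //; exact: qc.
  - by rewrite bev bE // => /esym; exact: qc.
  - rewrite !bE //; apply: intc => //; first by have [] := fP e eE.
    by have [+ _ _ _ _] := fP e' e'E; rewrite !in_itv /= => /andP[/ltW -> /ltW ->].
have arcs' e : e \in (ev |: E)%SET ->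
    [/\ {within `[0, 1]%classic, continuous (c' e)},
        {in `[0, 1] &, injective (c' e)} &
        exists a b, [/\ e = [set a; b]%SET, c' e 0 = p' a & c' e 1 = p' b]].
  rewrite in_setU1 /c'; have [-> _|ne /= eE] := eqVneq e ev.
    split.
    - apply: continuous_subspaceT => t; apply: cvgD; first exact: cvg_cst.
      by apply: (@cvgZr_tmp R (R * R)%type); exact: cvg_id.
    - move=> t u _ _ /addrI /eqP; rewrite -subr_eq0 -scalerBl scaler_eq0 subr_eq0.
      by case/orP => [/eqP//|]; rewrite -normr_eq0 qx0 gt_eqF.
    - exists x, v; split=> //; rewrite /p' ?(negPf xv) ?eqxx ?scale0r ?addr0 //.
      by rewrite scale1r addrC subrK.
  have [_ ? ? [a [d [eab c0 c1]]] _] := fP e eE; split => //; exists a, d.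
  have := isov e eE; rewrite {1}eab !inE negb_or => /andP[va vd].
  by rewrite !p'E // eq_sym.
have p'w w : w != x -> r <= `|p' w - x0|.
  by move=> wx; rewrite /p'; case: eqVneq => [_|_]; [rewrite qx0|rewrite ltW // rw].
(* Distances to [x0] decide: [x] is at distance 0, [v] is the excluded end [q], and all other
   vertices lie outside the disc. *)
have intv' e t w : e \in (ev |: E)%SET -> t \in `]0, 1[ -> c' e t <> p' w.
  move=> eE' t01; case: (no e t eE' t01) => [[u [u0 u1 uq br yE]] yw|[eE yr [t' t'01 yE]]].
    have yn := radial_norm _ _ _ u0 br yE.
    have [wx|wx] := eqVneq w x.
      move: yn; rewrite yw wx p'E // /x0 subrr normr0 => /esym/eqP.
      by rewrite mulf_eq0 !gt_eqF.
    have [wv|wv] := eqVneq w v.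
      have wq : p' w = q by rewrite /p' wv eqxx.
      have u_eq1 : u = 1.
        by apply: (mulIf (lt0r_neq0 r0)); rewrite -yn yw wq qx0 mul1r.
      move: yE uq; rewrite yw wq u_eq1 scale1r addrC subrK => ->.
      by rewrite ltxx => /(_ erefl).
    move: yn; rewrite yw p'E // => yn; have := rw w wx.
    by rewrite yn ltNge ler_piMl // ltW.
  have [->|wv] := eqVneq w v; last by rewrite yE p'E //; exact: intv.
  by move=> yv; move: yr; rewrite yv /p' eqxx qx0 ltxx.
exists p', c'; split => //.
- move=> w w'; rewrite /p'; case: eqVneq => [->|wv]; case: eqVneq => [->|w'v] //.
  + move=> qw; have [wx|/rw] := eqVneq w' x; last by rewrite -qw qx0 ltxx.
    by move: qx0 r0; rewrite qw wx subrr normr0 => ->; rewrite ltxx.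
  + move=> qw; have [wx|/rw] := eqVneq w x; last by rewrite qw qx0 ltxx.
    by move: qx0 r0; rewrite -qw wx subrr normr0 => ->; rewrite ltxx.
  + exact: pinj.
- by move=> e eE t t01 w; exact: intv'.
- move=> e e' eE e'E ne t t' t01.
  have [_ _ [a [d [_ c0 c1]]]] := arcs' e' e'E.
  move=> /ends[->|->|t'01]; [by rewrite c0; exact: intv'|by rewrite c1; exact: intv'|].
  (* Two radial points that agree have the same parameter, hence the same boundary point, against
     [binj]. A radial point is never outside the disc, and two old points are separated by the
     original drawing. *)
  move=> yy; case: (no e t eE t01) (no e' t' e'E t'01)
    => [[u [u0 u1 _ br yE]]|[eE0 yr [w w01 yE]]]
       [[u' [u'0 u'1 _ br' y'E]]|[e'E0 y'r [w' w'01 y'E]]].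
  + have := radial_norm _ _ _ u0 br yE.
    rewrite yy (radial_norm _ _ _ u'0 br' y'E) => /(mulIf (lt0r_neq0 r0)) uu.
    apply: (binj e e') => //; move: yE; rewrite yy y'E uu => /addrI.
    by move/(scalerI (lt0r_neq0 u0))/addIr.
  + by move: y'r; rewrite -yy (radial_norm _ _ _ u0 br yE) ltNge ler_piMl // ltW.
  + by move: yr; rewrite yy (radial_norm _ _ _ u'0 br' y'E) ltNge ler_piMl // ltW.
  + apply: (intc e e' eE0 e'E0 ne w w' w01); last by rewrite -yE -y'E.
    by move: w'01; rewrite !in_itv /= => /andP[/ltW -> /ltW ->].
Qed.

(** * Trees, tree components and planarity *)

Lemma planar_sub (R : realType) (V : finType) (E F : {set {set V}}) :
  F \subset E -> planar R E -> planar R F.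
Proof.
move=> /fintype.subsetP FE [p [c [pinj arcs intv intc]]]; exists p, c; split=> //.
- by move=> e /FE; exact: arcs.
- by move=> e /FE; exact: intv.
- by move=> e e' /FE eE /FE; exact: intc.
Qed.

(* [leaf_built y C F]: the tree with vertex set [C] and edge set [F] arises from
   the single vertex [y] by successively attaching leaves. *)
Inductive leaf_built (V : finType) (y : V) : {set V} -> {set {set V}} -> Prop :=
| leaf_built_root : leaf_built y [set y]%SET finset.set0
| leaf_built_attach C F a b : leaf_built y C F -> a \in C -> b \notin C ->
    leaf_built y (b |: C)%SET ([set a; b] |: F)%SET.

Section LeafBuilt.
Variable V : finType.
Implicit Types (x y z a b : V) (C D : {set V}) (E F : {set {set V}}).

Lemma leaf_built_mem y C F : leaf_built y C F -> y \in C.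
Proof.
by elim=> [|C' F' a b _ IH _ _]; rewrite !inE ?eqxx // IH orbT.
Qed.

Lemma leaf_built_edge y C F e : leaf_built y C F -> e \in F -> e \subset C.
Proof.
elim=> [|C' F' a b _ IH aC _]; first by rewrite inE.
rewrite in_setU1 => /predU1P[->|/IH eC].
  by rewrite finset.subUset !finset.sub1set !inE aC eqxx orbT.
exact: fintype.subset_trans eC (finset.subsetUr _ _).
Qed.

Lemma disjointsU1 x C D : [disjoint x |: C & D]%B = (x \notin D) && [disjoint C & D]%B.
Proof.
rewrite -disjointU1; apply: eq_disjoint => z.
by rewrite !inE.
Qed.

Lemma disjointsU C D (e : {set V}) :
  [disjoint e & C :|: D]%B = [disjoint e & C]%B && [disjoint e & D]%B.
Proof. by rewrite -!finset.setI_eq0 finset.setIUr finset.setU_eq0. Qed.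

(** The second tree is attached leaf by leaf, its root [b] coming first as a leaf at [a]. *)
Lemma leaf_built_append y C F a b D F' : leaf_built y C F -> a \in C ->
  leaf_built b D F' -> [disjoint C & D]%B ->
  leaf_built y (C :|: D)%SET ([set a; b] |: (F :|: F'))%SET.
Proof.
move=> tC aC; elim=> [|D' G c d _ IH cD dD] CD.
  rewrite finset.setU0 finset.setUC; apply: leaf_built_attach => //.
  by move: CD; rewrite disjoint_sym disjoints1.
have [dC CD'] : d \notin C /\ [disjoint C & D']%B.
  by move: CD; rewrite disjoint_sym disjointsU1 => /andP[-> ]; rewrite disjoint_sym.
rewrite !(finset.setUCA _ [set [set c; d]]%SET) (finset.setUCA C).
apply: leaf_built_attach; first exact: IH.
  by rewrite inE cD orbT.
by rewrite inE negb_or dC.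
Qed.

(** If [z] is the last leaf [b], start from [b] alone and append the remaining tree, rerooted at the
    neighbour [a] of [b]. *)
Lemma leaf_built_reroot y C F z : leaf_built y C F -> z \in C -> leaf_built z C F.
Proof.
move=> tC; elim: tC z => [|C' F' a b _ IH aC bC] z.
  by rewrite inE => /eqP ->; exact: leaf_built_root.
rewrite in_setU1 => /predU1P[->|zC]; last exact: leaf_built_attach (IH z zC) _ _.
rewrite (finset.setUC [set a]%SET) -[F']finset.set0U.
apply: leaf_built_append (leaf_built_root b) _ (IH a aC) _; first by rewrite inE.
by rewrite disjoints1.
Qed.

(** All vertices of [C] are isolated in [E], so [y] is added as a pendant vertex at [x] and the rest
    of the tree leaf by leaf, each time by [planar_pendant]. *)
Lemma planar_leaf_built (R : realType) E y C F x : leaf_built y C F ->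
  planar R E -> (forall e, e \in E -> [disjoint e & C]%B) -> x \notin C ->
  planar R ([set x; y] |: (F :|: E))%SET.
Proof.
move=> tC pE; elim: tC => [|C' F' a b tC IH aC bC] EC xC.
  rewrite finset.set0U; apply: planar_pendant => //; first by rewrite inE in xC.
  by move=> e /EC; rewrite disjoint_sym disjoints1.
rewrite -finset.setUA (finset.setUCA [set [set x; y]]%SET).
move: xC; rewrite !inE negb_or => /andP[xb xC].
apply: planar_pendant.
- by apply: IH => // e /EC; apply: disjointWr; exact: finset.subsetUr.
- by apply: contraNneq bC => <-.
have byC : b != y by apply: contraNneq bC => ->; exact: leaf_built_mem tC.
move=> e; rewrite !inE => /or3P[/eqP ->|eF|/EC].
- by rewrite !inE negb_or byC eq_sym xb.
- by apply: contra bC; have /fintype.subsetP := leaf_built_edge tC eF; apply.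
- by rewrite disjoint_sym disjointsU1 => /andP[].
Qed.

(** All edges meeting [C] are taken, not just those inside it: if they form a tree on [C], then by
    [leaf_built_edge] none leaves [C], which makes [C] a whole component. *)
Definition edges_at E C : {set {set V}} := [set e in E | ~~ [disjoint e & C]%B]%SET.

Definition tree_component E C : Prop := exists y, leaf_built y C (edges_at E C).

(** Deleting the edges at [C] isolates its vertices; the tree, rerooted at [y], is then drawn afresh
    next to [x]. Hence [x] and [y] need not share a face of the given drawing. *)
Lemma planar_join (R : realType) E C x y : planar R E -> tree_component E C ->
  y \in C -> x \notin C -> planar R ([set x; y] |: E)%SET.
Proof.
move=> pE [z /leaf_built_reroot tC] yC xC.
rewrite -[E](finset.setID _ (edges_at E C)).
have -> : (E :&: edges_at E C)%SET = edges_at E C.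
  by apply/finset.setIidPr/fintype.subsetP => e; rewrite inE => /andP[].
apply: planar_leaf_built (tC y yC) _ _ xC.
  exact: planar_sub (finset.subsetDl _ _) pE.
by move=> e; rewrite !inE negb_and negbK => /andP[/orP[/negPf ->|]].
Qed.

Lemma tree_component_nonadj E C x y : tree_component E C -> y \in C -> x \notin C ->
  [set x; y]%SET \notin E.
Proof.
move=> [z tC] yC xC; apply/negP => xyE; move/negP: xC; apply.
have /fintype.subsetP : ([set x; y] \subset C)%SET.
  apply: leaf_built_edge tC _; rewrite inE xyE /=.
  by apply/pred0Pn; exists y; rewrite /= !inE eqxx orbT.
by apply; rewrite !inE eqxx.
Qed.

Lemma tree_component_add E C (e : {set V}) : tree_component E C -> [disjoint e & C]%B ->
  tree_component (e |: E)%SET C.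
Proof.
move=> [y tC] eC; exists y; suff -> : edges_at (e |: E)%SET C = edges_at E C by [].
apply/finset.setP => f; rewrite !inE; case: eqVneq => // ->.
by rewrite eC !andbF.
Qed.

Lemma tree_component_merge E C D u v : tree_component E C -> tree_component E D ->
  [disjoint C & D]%B -> u \in C -> v \in D ->
  tree_component ([set u; v] |: E)%SET (C :|: D)%SET.
Proof.
move=> [y tC] [z tD] CD uC vD; exists y.
have := leaf_built_append tC uC (leaf_built_reroot tD vD) CD.
congr leaf_built; apply/finset.setP => f; rewrite !inE.
rewrite disjointsU negb_and -andb_orr.
case: eqVneq => //= ->; rewrite -[LHS]/true; apply/esym/orP; left.
by apply/pred0Pn; exists u; rewrite /= !inE eqxx uC.
Qed.

(** Induction on the number of edges, from the singletons of the empty graph: each further edge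
    costs at most one member of the family. *)
Lemma many_tree_components E : simple_graph E ->
  exists S : {set {set V}}, [/\ finset.trivIset S,
    forall C, C \in S -> tree_component E C & (#|V| <= #|S| + #|E|)%N].
Proof.
move: {2}#|E| (erefl #|E|) => n; elim: n E => [|n IH] E cE sE.
  move: cE => /eqP; rewrite cards_eq0 => /eqP ->.
  exists [set [set y] | y : V]%SET; split.
  - apply/finset.trivIsetP => _ _ /imsetP[a _ ->] /imsetP[b _ ->].
    by rewrite disjoints1 inE; apply: contraNN => /eqP ->.
  - move=> _ /imsetP[a _ ->]; exists a.
    suff -> : edges_at finset.set0 [set a] = finset.set0 by exact: leaf_built_root.
    by apply/finset.setP => f; rewrite !inE.
  - by rewrite card_imset ?addn_gt0 ?cards0 ?addn0 //; exact: finset.set1_inj.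
have [e eE] : exists e, e \in E by apply/card_gt0P; rewrite cE.
have /cards2P[u [v [uv euv]]] : #|e| == 2%N by exact: (forall_inP sE).
have [||S [tS SC cS]] := IH (E :\ e)%SET.
- by apply/eqP; move: cE; rewrite (cardsD1 e) eE add1n => -[/eqP].
- by apply/forall_inP => f; rewrite !inE => /andP[_]; exact: (forall_inP sE).
have EE : E = (e |: (E :\ e))%SET by rewrite finset.setD1K.
have S0 : finset.set0 \notin S.
  by apply/negP => /SC[y /leaf_built_mem]; rewrite inE.
have SD C D : C \in S -> D \in S -> C != D -> [disjoint C & D]%B.
  by move/finset.trivIsetP : tS; apply.
have cE' : #|E| = (#|(E :\ e)%SET|).+1 by rewrite (cardsD1 e) eE.
(* If the edge joins two members of [S], these are merged into one tree component. *)
have [/existsP[C /existsP[D /and5P[CS DS CD uC vD]]]|no] :=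
    boolP [exists C, exists D, [&& C \in S, D \in S, C != D, u \in C & v \in D]].
  have [tT CDT] : finset.trivIset ((C :|: D) |: (S :\ C :\ D))%SET /\
      (C :|: D)%SET \notin (S :\ C :\ D)%SET.
    apply: trivIsetU1.
    - move=> B; rewrite !inE => /and3P[BD BC BS].
      by rewrite disjoint_sym disjointsU !SD.
    - by do 2 apply: trivIsetD.
    - by rewrite !inE (negPf S0) !andbF.
  exists ((C :|: D) |: (S :\ C :\ D))%SET; split=> //.
  - move=> B; rewrite in_setU1 EE => /predU1P[->|].
      by rewrite euv; apply: tree_component_merge => //; rewrite -?euv;
        [exact: SC|exact: SC|exact: SD].
    rewrite !inE => /and3P[BD BC BS]; apply: tree_component_add (SC B BS) _.
    rewrite euv disjointsU1 disjoints1; apply/andP; split.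
      by rewrite (disjointFr (SD C B CS BS _)) // eq_sym.
    by rewrite (disjointFr (SD D B DS BS _)) // eq_sym.
  - rewrite cardsU1 CDT cE'; apply: leq_trans cS _.
    rewrite (cardsD1 C S) CS (cardsD1 D (S :\ C)%SET) !inE DS eq_sym CD /=.
    by rewrite !addnA !add1n !addSn addnS.
(* Otherwise the members that meet [e] are dropped. There is at most one, since two distinct ones
   would contain one end of [e] each. *)
pose T := [set C in S | [disjoint e & C]%B]%SET.
exists T; split.
- by apply/finset.trivIsetP => C D; rewrite !inE => /andP[CS _] /andP[DS _]; exact: SD.
- move=> C; rewrite inE EE => /andP[CS eC].
  exact: tree_component_add (SC C CS) _.
- rewrite cE'; apply: leq_trans cS _; rewrite addnS -addSn leq_add2r.
  rewrite -(cardsID T S) (_ : (S :&: T)%SET = T); last first.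
    by apply/finset.setP => C; rewrite !inE; case: (C \in S).
  rewrite -addn1 leq_add2l; apply/card_le1_eqP => C D.
  rewrite !inE => /andP[CT CS] /andP[DT DS].
  move: CT DT; rewrite CS DS /= euv !disjointsU1 !disjoints1 !negb_and !negbK.
  move=> CT DT; apply/eqP/negPn; rewrite eq_sym; apply/negP => CD.
  have dCD := SD _ _ CS DS CD.
  move/negP: no; apply; case/orP: CT => [uC|vC]; case/orP: DT => [uD|vD].
  - by move: (disjointFr dCD uC); rewrite uD.
  - by apply/existsP; exists C; apply/existsP; exists D; apply/and5P.
  - by apply/existsP; exists D; apply/existsP; exists C; rewrite eq_sym; apply/and5P.
  - by move: (disjointFr dCD vC); rewrite vD.
Qed.

End LeafBuilt.

(** * Counting edge additions and copies *)

Lemma card_pairs (A B : finType) (P : A -> B -> bool) :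
  #|[set t : A * B | P t.1 t.2]%SET| = (\sum_a #|[set b | P a b]%SET|)%N.
Proof.
rewrite -sum1_card (eq_bigl (fun t => true && P t.1 t.2)); last by move=> t; rewrite inE.
rewrite -(pair_big_dep xpredT P (fun _ _ => 1%N)) /=; apply: eq_bigr => a _.
by rewrite -sum1_card; apply: eq_bigl => b; rewrite inE.
Qed.

Section Counting.
Variable R : realType.
Local Notation P := (planar_graphs R).

Lemma planar_graphs_add (n j : nat) (E : {set {set 'I_n}}) (x y : 'I_n)
    (C : {set 'I_n}) :
  E \in P n j -> tree_component E C -> y \in C -> x \notin C ->
  ([set x; y]%SET \notin E) && (([set x; y] |: E)%SET \in P n j.+1).
Proof.
rewrite !inE => /and3P[sE /eqP cE /asboolP pE] tC yC xC.
have nE := tree_component_nonadj tC yC xC.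
rewrite nE /=; apply/and3P; split.
- apply/forall_inP => f; rewrite in_setU1 => /predU1P[->|]; last exact: (forall_inP sE).
  by rewrite cards2 (_ : x != y) //; apply: contraNneq xC => ->.
- by rewrite cardsU1 nE cE.
- by apply/asboolP; exact: planar_join pE tC yC xC.
Qed.

(** At most one of the disjoint tree components contains [x], whence the predecessor; every other
    one supplies a vertex [y] of its own. *)
Lemma many_additions (n j : nat) (E : {set {set 'I_n}}) (x : 'I_n) : E \in P n j ->
  ((n - j).-1 <= #|[set y | ([set x; y]%SET \notin E) &&
                   (([set x; y] |: E)%SET \in P n j.+1)]%SET|)%N.
Proof.
move=> EP; have : E \in P n j by [].
rewrite inE => /and3P[sE /eqP cE _].
have [S [tS SC cS]] := many_tree_components sE.
pose S' := [set C in S | x \notin C]%SET.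
have cS' : ((n - j).-1 <= #|S'|)%N.
  suff : (#|S| <= #|S'| + 1)%N by move: cS; rewrite card_ord cE; lia.
  rewrite -(cardsID S' S) leq_add //.
    by apply: subset_leq_card; exact: finset.subsetIr.
  apply/card_le1_eqP => C D; rewrite !inE !negb_and !negbK.
  move=> /andP[xC CS] /andP[xD DS]; move: xC xD; rewrite CS DS /= => xC xD.
  apply/eqP/negPn/negP => DC.
  have := finset.trivIsetP tS _ _ DS CS DC.
  by move/disjointFr => /(_ _ xD); rewrite xC.
apply: leq_trans cS' _.
pose rt (C : {set 'I_n}) := odflt x [pick y in C].
have rtP C : C \in S -> rt C \in C.
  move=> /SC[y /leaf_built_mem yC]; rewrite /rt; case: pickP => //= C0.
  by move: (C0 y); rewrite yC.
rewrite -(@card_in_imset _ _ rt).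
  apply: subset_leq_card; apply/fintype.subsetP => _ /imsetP[C + ->].
  rewrite !inE => /andP[CS xC].
  by have := planar_graphs_add EP (SC C CS) (rtP C CS) xC; rewrite inE.
move=> C D; rewrite !inE => /andP[CS _] /andP[DS _] rtE.
apply/eqP/negPn/negP => CD.
have := finset.trivIsetP tS _ _ CS DS CD.
by move/disjointFr => /(_ _ (rtP C CS)); rewrite rtE rtP.
Qed.

(* The factor 4 is a crude bound for the two ordered pairs with [{x, y} = e]: they
   are among the four elements of [e * e]. *)
Lemma card_planar_step (n j : nat) :
  (#|P n j| * (n * (n - j).-1) <= #|P n j.+1| * (4 * j.+1))%N.
Proof.
pose ok (E : {set {set 'I_n}}) (t : 'I_n * 'I_n) :=
  ([set t.1; t.2]%SET \notin E) && (([set t.1; t.2] |: E)%SET \in P n j.+1).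
(* [X] pairs a graph with an ordered pair that can be added as an edge, [Y] a larger graph with an
   ordered pair that is an edge. *)
pose X := [set u : {set {set 'I_n}} * ('I_n * 'I_n) | (u.1 \in P n j) && ok u.1 u.2]%SET.
pose Y := [set u : {set {set 'I_n}} * ('I_n * 'I_n) |
  (u.1 \in P n j.+1) && ([set u.2.1; u.2.2]%SET \in u.1)]%SET.
have lower : (#|P n j| * (n * (n - j).-1) <= #|X|)%N.
  rewrite /X (card_pairs (fun E t => (E \in P n j) && ok E t)).
  rewrite -sum_nat_const [X in (_ <= X)%N](bigID (mem (P n j))) /=.
  apply: leq_trans (leq_addr _ _); apply: leq_sum => E EP.
  rewrite (_ : [set _ | _]%SET = [set t | ok E (t.1, t.2)]%SET); last first.
    by apply/finset.setP => -[a b]; rewrite [LHS]inE [RHS]inE EP.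
  rewrite (card_pairs (fun a b => ok E (a, b))).
  rewrite -[X in (X * _ <= _)%N]card_ord -sum_nat_const; apply: leq_sum => x _.
  exact: many_additions.
have XY : (#|X| <= #|Y|)%N.
  (* The added pair is remembered and was not an edge before, so it can be removed again: [g] is
     injective on [X]. *)
  pose g (u : {set {set 'I_n}} * ('I_n * 'I_n)) := (([set u.2.1; u.2.2] |: u.1)%SET, u.2).
  rewrite -(@card_in_imset _ _ g).
    apply: subset_leq_card; apply/fintype.subsetP => _ /imsetP[[E [a b]] + ->].
    rewrite inE => /and3P[_ _ abE]; rewrite inE abE /=.
    by rewrite !inE eqxx.
  move=> [E [a b]] [F [c d]]; rewrite inE => /and3P[_ /= abE _];
    rewrite inE => /and3P[_ /= cdF _].
  case=> EF ac bd; rewrite -{}ac -{}bd in cdF EF *; congr pair.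
  by rewrite -(finset.setU1K abE) EF finset.setU1K.
apply: leq_trans lower (leq_trans XY _).
rewrite /Y (card_pairs (fun E t => (E \in P n j.+1) && ([set t.1; t.2]%SET \in E))).
rewrite (bigID (mem (P n j.+1))) /= [X in (_ + X)%N]big1 ?addn0; last first.
  move=> E /negPf EP; apply/eqP; rewrite cards_eq0.
  by apply/eqP/finset.setP => t; rewrite [LHS]inE EP inE.
rewrite -sum_nat_const; apply: leq_sum => E.
rewrite inE => /and3P[sE /eqP cE _].
rewrite mulnC -{2}cE -sum_nat_const.
apply: (@leq_trans #|(\bigcup_(e in E) finset.setX e e)%SET|).
  apply: subset_leq_card; apply/fintype.subsetP => -[a b]; rewrite !inE /= => /andP[_ abE].
  apply/bigcupP; exists [set a; b]%SET => //; by rewrite !inE !eqxx orbT.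
apply: (@leq_trans (\sum_(e in E) #|finset.setX e e|)%N).
  elim/big_ind2 : _ => //.
    by rewrite cards0.
  move=> a A b B hA hB; apply: leq_trans (leq_add hA hB).
  by rewrite cardsU leq_subr.
apply: leq_sum => e eE; rewrite cardsX.
by have /eqP -> : #|e| == 2%N by exact: (forall_inP sE).
Qed.

Lemma card_planar_steps (n m i : nat) : (i <= m)%N ->
  (#|P n (m - i)| * (n * (n - m)) ^ i <= #|P n m| * (4 * m) ^ i)%N.
Proof.
elim: i => [|i IH] im; first by rewrite subn0 !expn0.
have {}IH := IH (ltnW im).
have := card_planar_step n (m - i.+1).
have -> : (m - i.+1).+1 = (m - i)%N by rewrite subnSK.
move=> step; rewrite !expnS.
(* Because [m - i.+1 < m], the predecessor is absorbed and each factor is at least [n * (n - m)]; on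
   the other side [4 * (m - i)] will be replaced by [4 * m]. *)
apply: (@leq_trans (#|P n (m - i.+1)| * (n * (n - (m - i.+1)).-1) * (n * (n - m)) ^ i)).
  by rewrite mulnA; do 3 (apply: leq_mul => //); lia.
apply: leq_trans (leq_mul step (leqnn _)) _.
rewrite mulnAC; apply: leq_trans (leq_mul IH (leqnn _)) _.
rewrite -mulnA; apply: leq_mul => //; rewrite mulnC; apply: leq_mul => //.
by rewrite leq_mul2l leq_subr orbT.
Qed.

(** A graph is recovered from the map [f] of a chosen copy and the graph left after deleting that
    copy. As [f] is injective, exactly [#|H|] edges are deleted. *)
Lemma card_has_copy (V : finType) (H : {set {set V}}) (n m : nat) :
  (#|[set G in P n m | has_copy H G]%SET| <= #|P n (m - #|H|)| * n ^ #|V|)%N.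
Proof.
pose copy (G : {set {set 'I_n}}) (f : {ffun V -> 'I_n}) :=
  injectiveb f && ([set f @: e | e : {set V} in H] \subset G)%SET.
pose g (G : {set {set 'I_n}}) : option ({set {set 'I_n}} * {ffun V -> 'I_n}) :=
  if [pick f | copy G f] is Some f then
    Some (G :\: [set f @: e | e : {set V} in H], f)%SET else None.
pose Z := [set Some t | t : {set {set 'I_n}} * {ffun V -> 'I_n} in
   finset.setX (P n (m - #|H|)) [set: {ffun V -> 'I_n}]]%SET.
have <- : #|Z| = (#|P n (m - #|H|)| * n ^ #|V|)%N.
  by rewrite card_imset ?cardsX ?cardsT ?card_ffun ?card_ord //; exact: Some_inj.
have gP G : has_copy H G -> exists2 f, copy G f &
    g G = Some (G :\: [set f @: e | e : {set V} in H], f)%SET.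
  move=> /existsP[f Gf]; rewrite /g; case: pickP => [f' Gf'|/(_ f)]; first by exists f'.
  by rewrite /copy Gf.
rewrite -(@card_in_imset _ _ g).
  apply: subset_leq_card; apply/fintype.subsetP => _ /imsetP[G + ->].
  rewrite inE => /andP[GP /gP[f /andP[/injectiveP fi fG] ->]].
  apply: imset_f; rewrite finset.in_setX finset.in_setT andbT.
  move: GP; rewrite !inE => /and3P[sG /eqP cG /asboolP pG]; apply/and3P; split.
  - apply/forall_inP => e; rewrite inE => /andP[_]; exact: (forall_inP sG).
  - rewrite cardsD (finset.setIidPr fG) card_imset ?cG //; exact: imset_inj.
  - by apply/asboolP; apply: planar_sub pG; exact: finset.subsetDl.
move=> G G'; rewrite !inE => /andP[_ /gP[f /andP[_ fG] ->]] /andP[_ /gP[f' /andP[_ f'G'] ->]].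
case=> + ff'; rewrite -{}ff' in f'G' * => GG'.
rewrite -(finset.setID G [set f @: e | e : {set V} in H]%SET).
rewrite -[RHS](finset.setID G' [set f @: e | e : {set V} in H]%SET).
by rewrite GG' !(finset.setIidPr _).
Qed.
End Counting.

Lemma card_has_copy_le (R : realType) (V : finType) (H : {set {set V}}) (n m : nat) :
  (#|[set G in planar_graphs R n m | has_copy H G]%SET| * (n * (n - m)) ^ #|H| <=
   #|planar_graphs R n m| * n ^ #|V| * (4 * m) ^ #|H|)%N.
Proof.
have [Hm|mH] := leqP #|H| m.
  apply: leq_trans (leq_mul (card_has_copy R H n m) (leqnn _)) _.
  by rewrite mulnAC [X in (_ <= X)%N]mulnAC leq_mul // card_planar_steps.
(* With fewer than [#|H|] edges there is no copy; here the truncated [m - #|H|] would be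
   meaningless. *)
rewrite (_ : [set _ | _]%SET = finset.set0) ?cards0 //.
apply/finset.setP => G; rewrite !inE; apply/negP => /andP[/and3P[_ /eqP cG _]].
move=> /existsP[f /andP[/injectiveP fi /subset_leq_card]].
by rewrite card_imset ?cG; [rewrite leqNgt mH|exact: imset_inj].
Qed.

(** * Passage to the limit *)

Lemma limn_esup_lt1_linear (R : realType) (m : nat -> nat) :
  (limn_esup (fun n => ((m n)%:R / n%:R : R)%:E) < 1)%E ->
  exists2 d : R, 0 < d & \forall n \near \oo, (m n)%:R <= (1 - d) * n%:R.
Proof.
(* The limit superior is an infimum of suprema over neighbourhoods of infinity, so one supremum [s]
   is already below 1, and [d] is 1 minus a real bound. If [s] is [-oo], the neighbourhood has no
   element and any bound will do. *)
move=> /ereal_inf_lt [y [A Aoo <-]]; set s := ereal_sup _ => s1.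
have uA n : A n -> (((m n)%:R / n%:R : R)%:E <= s)%E.
  by move=> An; apply: ereal_sup_ubound; exists n.
have [c c1 cA] : exists2 c : R, c < 1 & forall n, A n -> (m n)%:R / n%:R <= c.
  case: s s1 uA => [r| |] // s1 uA; first by exists r.
  by exists 0 => // n /uA.
exists (1 - c); first by rewrite subr_gt0.
near=> n.
rewrite opprB addrC subrK -ler_pdivrMr; first by apply: cA; near: n.
by rewrite ltr0n; near: n; exact: nbhs_infty_gt.
Unshelve. all: by end_near. Qed.

(** To be used with [N] = n^h, [v] = n^|V| and [x] = n, where h is the number of edges of [H]: the
    hypothesis [v * x <= N] is then where multicyclicity enters. *)
Lemma cancel_factors (R : realFieldType) (b q D F N v x : R) :
  0 <= q -> 0 <= F -> 0 < N -> 0 <= x -> v * x <= N ->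
  b * (D * (N * N)) <= q * v * (F * N) -> b * x * D <= q * F.
Proof.
move=> q0 F0 N0 x0 vx key; rewrite -(ler_pM2r (mulr_gt0 N0 N0)).
have -> : b * x * D * (N * N) = b * (D * (N * N)) * x by ring.
apply: (le_trans (ler_wpM2r x0 key)).
have -> : q * v * (F * N) * x = q * (F * N) * (v * x) by ring.
have -> : q * F * (N * N) = q * (F * N) * N by ring.
by rewrite ler_wpM2l // !mulr_ge0 // ltW.
Qed.

Theorem theorem5p6 (R : realType) (V : finType) (H : {set {set V}})
    (m : nat -> nat)
    (simpleH : simple_graph H) (planarH : planar R H)
    (multicyclicH : multicyclic H)
    (limsup_m : (limn_esup (fun n => ((m n)%:R / n%:R : R)%:E) < 1)%E) :
  (fun n => prob_uniform R (planar_graphs R n (m n)) (fun G => has_copy H G))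
    @ \oo --> (0 : R).
Proof.
have [d d0 md] := limn_esup_lt1_linear limsup_m.
have VH : (#|V| < #|H|)%N by case/andP: multicyclicH.
set h := #|H| in VH *; pose K : R := (4 / d) ^+ h.
have K0 : 0 <= K by rewrite exprn_ge0 // divr_ge0 // ltW.
(* The probability will be at most [K / n]. As [harmonic n] is 1/(n + 1), the factor 2 accounts for
   1/n <= 2/(n + 1) when n >= 1. *)
have lim0 : (fun n => (2 * K) * harmonic n) @ \oo --> (0 : R).
  by rewrite -[X in _ --> X](mulr0 (2 * K)); apply: cvgMl_tmp; exact: cvg_harmonic.
apply: (squeeze_cvgr _ (cvg_cst (0 : R)) lim0).
near=> n; rewrite /prob_uniform.
have n_gt0 : (0 < n)%N by near: n; exact: nbhs_infty_gt.
have mn : (m n)%:R <= (1 - d) * n%:R :> R by near: n.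
set B := #|_|; set Q := #|_|.
have n0 : 0 < n%:R :> R by rewrite ltr0n.
rewrite divr_ge0 //=.
apply: (@le_trans _ _ (K / n%:R)); last first.
  rewrite /= [2 * K]mulrC -mulrA ler_wpM2l // ler_pdivlMr ?ltr0n //.
  by rewrite mulrC ler_pdivrMr // -natrM ler_nat; lia.
have dn : d * n%:R <= (n - m n)%:R.
  by rewrite natrB; last (rewrite -(ler_nat R)); nra.
have mnn : (m n)%:R <= n%:R :> R by nra.
have key : B%:R * (d * n%:R ^+ 2) ^+ h <= Q%:R * n%:R ^+ #|V| * (4 * n%:R) ^+ h :> R.
  apply: (@le_trans _ _ (B%:R * (n%:R * (n - m n)%:R) ^+ h)).
    apply: ler_wpM2l => //; apply: lerXn2r; rewrite ?nnegrE.
    - by rewrite mulr_ge0 ?exprn_ge0 // ltW.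
    - by rewrite mulr_ge0.
    - by rewrite expr2 mulrCA ler_wpM2l.
  apply: (@le_trans _ _ (Q%:R * n%:R ^+ #|V| * (4 * (m n)%:R) ^+ h)).
    by rewrite -!natrX -!natrM -!natrX -!natrM ler_nat card_has_copy_le.
  apply: ler_wpM2l; first by rewrite mulr_ge0 // exprn_ge0.
  apply: lerXn2r; rewrite ?nnegrE ?mulr_ge0 //.
  by rewrite ler_wpM2l.
have {}key : B%:R <= Q%:R * (K / n%:R) :> R.
  have nV : n%:R ^+ #|V| * n%:R <= n%:R ^+ h :> R.
    by rewrite -exprSr -!natrX ler_nat leq_pexp2l.
  have D0 : 0 < d ^+ h by exact: exprn_gt0.
  have N0 : 0 < n%:R ^+ h :> R by exact: exprn_gt0.
  rewrite /K expr_div_n mulrA ler_pdivlMr // mulrA ler_pdivlMr //.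
  move: key; rewrite expr2 !exprMn.
  by apply: cancel_factors => //; rewrite ?exprn_ge0 ?ltW.
(* If there is no graph at all, division by 0 makes the probability 0. *)
have [Q0|Q0] := posnP Q; first by rewrite Q0 invr0 mulr0 divr_ge0.
by rewrite ler_pdivrMr ?ltr0n // mulrC.
Unshelve. all: by end_near. Qed.
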